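(* For every $n\ge 1$ there is a q-Horn CNF formula $\varphi_n$ of size $O(n)$ such that (a) every URC formula equivalent to $\varphi_n$ has size $2^{\Omega(n)}$, and (b) there is a PC (and hence URC) encoding of (the function represented by) $\varphi_n$ of size $O(n)$.
   Context: A CNF formula is a set of clauses; its size is the number of clauses. A CNF $\varphi$ is q-Horn if there is a valuation $\gamma$ assigning to each literal $u$ on the variables of $\varphi$ a value $\gamma(u)\in\{0,\tfrac12,1\}$ with $\gamma(u)+\gamma(\neg u)=1$, such that $\sum_{u\in C}\gamma(u)\le 1$ for every clause $C\in\varphi$. A partial assignment $\alpha$ of variables $\mathbf{x}$ is a set of literals on $\mathbf{x}$ with no complementary pair, identified with the conjunction of its literals. Unit resolution derives $C\setminus\{l\}$ from a clause $C\ni l$ and the unit clause $\neg l$; $\varphi\vdash_1 C$ means $C$ is derivable by repeated unit resolution; $\bot$ is the empty clause. $\varphi(\mathbf{x})$ is URC if for every partial assignment $\alpha$ of $\mathbf{x}$, $\varphi\wedge\alpha\models\bot$ implies $\varphi\wedge\alpha\vdash_1\bot$; it is PC if for every partial assignment $\alpha$ and literal $l$ on $\mathbf{x}$ with $\varphi\wedge\alpha\models l$ we have $\varphi\wedge\alpha\vdash_1 l$ or $\varphi\wedge\alpha\vdash_1\bot$. A URC formula equivalent to $\varphi_n$ uses only the variables of $\varphi_n$. A CNF $\psi(\mathbf{x},\mathbf{y})$ is an encoding of a Boolean function $f(\mathbf{x})$ if $f(\mathbf{a})=\exists\mathbf{b}\,\psi(\mathbf{a},\mathbf{b})$ for all $\mathbf{a}\in\{0,1\}^{\mathbf{x}}$;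 a PC (URC) encoding is an encoding that is a PC (URC) formula over all its variables. *)

(* Defs.v *)
From HB Require Import structures.
From mathcomp Require Import all_boot all_order all_algebra.

Set Implicit Arguments.
Unset Strict Implicit.
Unset Printing Implicit Defensive.

(* The literal (v, true) is the variable v, and (v, false) is its negation. *)
Definition literal (V : finType) : finType := (V * bool)%type.
Definition clause (V : finType) : finType := {set literal V}.

(* A formula phi(x) is a CNF over the finite type V of the variables x;
   its size is #|phi|. *)
Definition cnf (V : finType) : finType := {set clause V}.

Section Formulas.
Variable V : finType.
Implicit Types (u l : literal V) (C : clause V) (phi psi : cnf V).
Implicit Type alpha : {set literal V}.

Definition neg u : literal V := (u.1, ~~ u.2).

Definition vars phi : {set V} := [set u.1 | u in cover phi].

Definition clause_eval C (a : V -> bool) : bool := [exists u in C, a u.1 == u.2].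

Definition cnf_eval phi (a : V -> bool) : bool :=
  [forall C in phi, clause_eval C a].

Definition equivalent phi psi : Prop := cnf_eval phi =1 cnf_eval psi.

Definition entails phi C : Prop :=
  forall a : V -> bool, cnf_eval phi a -> clause_eval C a.

Inductive unit_derives phi : clause V -> Prop :=
| ud_axiom C : C \in phi -> unit_derives phi C
| ud_resolve C l :
    unit_derives phi C -> l \in C -> unit_derives phi [set neg l] ->
    unit_derives phi (C :\ l).

Definition bot : clause V := set0.
Definition unit_clause l : clause V := [set l].

Definition partial_assignment alpha : Prop :=
  forall u, u \in alpha -> neg u \notin alpha.

Definition conj_assignment phi alpha : cnf V :=
  phi :|: [set unit_clause u | u in alpha].

Definition URC phi : Prop :=
  forall alpha, partial_assignment alpha ->
    entails (conj_assignment phi alpha) bot ->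
    unit_derives (conj_assignment phi alpha) bot.

Definition PC phi : Prop :=
  forall alpha l, partial_assignment alpha ->
    entails (conj_assignment phi alpha) (unit_clause l) ->
    unit_derives (conj_assignment phi alpha) (unit_clause l) \/
    unit_derives (conj_assignment phi alpha) bot.

Definition qHorn phi : Prop :=
  exists gamma : literal V -> rat,
    [/\ forall u, gamma u \in [:: 0; 2^-1; 1]%R,
        forall u, (gamma u + gamma (neg u))%R = 1%R
      & forall C, C \in phi -> (\sum_(u in C) gamma u <= 1)%R].

End Formulas.

Arguments bot {V}.

Definition join_assignment (V W : finType) (a : V -> bool) (b : W -> bool)
    (v : V + W) : bool :=
  match v with inl x => a x | inr y => b y end.

(* psi(x, y) has its variables in V + W: x in V and the auxiliary y in W. *)
Definition encoding (V W : finType) (psi : cnf (V + W)%type)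
    (f : (V -> bool) -> bool) : Prop :=
  forall a : V -> bool,
    f a <-> exists b : W -> bool, cnf_eval psi (join_assignment a b).

(* Main.v *)
Require Import Defs.
From HB Require Import structures.
From mathcomp Require Import all_boot all_order all_algebra.
From mathcomp Require Import boolp.

(* Take nodes y_i around a cycle of length m = 3n, where link i says that
   y_i and y_(i+1) agree, except that the last link says that they differ. The
   links are jointly inconsistent, but any m - 1 of them are satisfiable, by two
   complementary solutions. In phi_n each link i is enforced by either of two
   selectors x_(i,0), x_(i,1); giving the selectors value 1 and the nodes value
   1/2 shows that phi_n is q-Horn.

   A choice z of one selector per link makes phi_n unsatisfiable. The first step
   of a unit refutation from z uses a clause with at most one literal outside
   the clause C_z of negated chosen selectors, and such an implicate of phi_n
   misses at most one literal of C_z. Hence the choices in the threefold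
   repetition code need 2^n distinct clauses.

   A small PC encoding has a gate w_i implied by both selectors of link i and
   enforcing it, and the single clause stating that some gate is off. *)

Set Implicit Arguments.
Unset Strict Implicit.
Unset Printing Implicit Defensive.

(** * Unit propagation in arbitrary CNF formulas *)

Section Propagation.
Variable V : finType.
Implicit Types (u l : literal V) (C D : clause V) (phi psi : cnf V).
Implicit Type alpha : {set literal V}.

Lemma negK : involutive (@neg V).
Proof. by case=> x b; rewrite /neg /= negbK. Qed.

Lemma clause_evalP C (a : V -> bool) :
  reflect (exists2 u, u \in C & a u.1 = u.2) (clause_eval C a).
Proof.
apply: (iffP existsP) => [[u /andP[uC /eqP au]]|[u uC au]]; first by exists u.
by exists u; rewrite uC au eqxx.
Qed.

Lemma cnf_evalP phi (a : V -> bool) :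
  reflect (forall C, C \in phi -> clause_eval C a) (cnf_eval phi a).
Proof. exact: forall_inP. Qed.

Lemma cnf_eval_conj phi alpha (a : V -> bool) :
  cnf_eval (conj_assignment phi alpha) a <->
  cnf_eval phi a /\ forall u, u \in alpha -> a u.1 = u.2.
Proof.
split=> [/cnf_evalP sat | [/cnf_evalP sat aP]].
  split; first by apply/cnf_evalP => C Cphi; apply: sat; rewrite inE Cphi.
  move=> u ualpha; have : unit_clause u \in conj_assignment phi alpha.
    by rewrite inE imset_f ?orbT.
  by move/sat/clause_evalP => [v /set1P ->].
apply/cnf_evalP => C /setUP[/sat //|/imsetP[u ualpha ->]].
by apply/clause_evalP; exists u; [rewrite inE | apply: aP].
Qed.

Lemma unit_derives_setD phi C (A : {set literal V}) :
  unit_derives phi C -> {in A, forall u, unit_derives phi [set neg u]} ->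
  unit_derives phi (C :\: A).
Proof.
move: {2}#|A| (erefl #|A|) => k; elim: k A => [|k IH] A cA dC dA.
  by move/eqP: cA; rewrite cards_eq0 => /eqP ->; rewrite setD0.
have [u uA] : exists u, u \in A by apply/card_gt0P; rewrite cA.
have dCA : unit_derives phi (C :\: (A :\ u)).
  apply: IH => //; first by move: cA; rewrite (cardsD1 u) uA => -[].
  by move=> v /setD1P[_ /dA].
have -> : C :\: A = (C :\: (A :\ u)) :\ u.
  apply/setP=> v; rewrite !inE; case: eqP => [->|_] //=; by rewrite uA.
have [uC|uC] := boolP (u \in C :\: (A :\ u)).
  by apply: ud_resolve => //; apply: dA.
by rewrite (_ : _ :\ u = C :\: (A :\ u)) //; apply/setDidPl; rewrite disjoint_sym disjoints1.
Qed.

Lemma unit_derives_last phi C u :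
  C \in phi -> u \in C ->
  (forall v, v \in C -> v != u -> unit_derives phi [set neg v]) ->
  unit_derives phi [set u].
Proof.
move=> Cphi uC dC; rewrite (_ : [set u] = C :\: (C :\ u)).
  apply: unit_derives_setD; first exact: ud_axiom.
  by move=> v /setD1P[vu vC]; apply: dC.
by apply/setP=> v; rewrite !inE; case: eqP => [->|_] /=; rewrite ?uC ?andNb.
Qed.

Lemma unit_derives_falsified phi C :
  C \in phi -> (forall v, v \in C -> unit_derives phi [set neg v]) ->
  unit_derives phi bot.
Proof.
move=> Cphi dC; rewrite (_ : bot = C :\: C); last by rewrite setDv.
by apply: unit_derives_setD; first exact: ud_axiom.
Qed.

Lemma unit_derives_clash phi u :
  unit_derives phi [set u] -> unit_derives phi [set neg u] ->
  unit_derives phi bot.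
Proof.
move=> du dnu; rewrite (_ : bot = [set u] :\ u); last by rewrite setDv.
by apply: ud_resolve; rewrite ?inE.
Qed.

(** An inconsistent formula entails both literals of [v], and deriving both yields [bot]. *)
Lemma PC_URC (v : V) phi : PC phi -> URC phi.
Proof.
move=> pc alpha pa unsat.
have unsatl C : entails (conj_assignment phi alpha) C.
  by move=> a /unsat/clause_evalP[u]; rewrite inE.
have [du|//] := pc alpha (v, true) pa (unsatl _).
have [dnu|//] := pc alpha (v, false) pa (unsatl _).
exact: unit_derives_clash du dnu.
Qed.

(* If every clause of psi that alpha does not satisfy keeps two unfalsified
   literals, then no unit resolution step is possible beyond those of alpha. *)
Lemma unit_refutation_starts psi alpha :
  partial_assignment alpha -> unit_derives (conj_assignment psi alpha) bot ->
  exists2 D, D \in psi &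
    [disjoint D & alpha] /\ #|D :\: [set neg u | u in alpha]| <= 1.
Proof.
move=> pa dbot.
suff /exists_inP[D Dpsi /andP[? ?]] : [exists D in psi,
  [disjoint D & alpha] && (#|D :\: [set neg u | u in alpha]| <= 1)].
  by exists D.
apply: contraPT dbot => /exists_inPn none dbot.
have inv C : unit_derives (conj_assignment psi alpha) C ->
    ~~ [disjoint C & alpha] \/ 1 < #|C :\: [set neg u | u in alpha]|.
  elim=> {C} [C /setUP[/none|/imsetP[u ualpha ->]] | C l _ IH lC _ IHl].
  - by rewrite negb_and -ltnNge => /orP.
  - by left; rewrite disjoints1 negbK.
  (* A unit clause cannot keep two unfalsified literals, so the unit resolved with lies in [alpha]
     and [l] was falsified already. *)
  have nlalpha : neg l \in alpha.
    case: IHl => [|]; first by rewrite disjoints1 negbK.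
    by rewrite ltnNge (leq_trans (subset_leq_card (subsetDl _ _))) ?cards1.
  have lalpha : l \notin alpha by rewrite -(negK l) pa.
  case: IH => [/pred0Pn[u /andP[uC ualpha]] | two].
    left; apply/pred0Pn; exists u; rewrite /= in_setD1 (_ : u != l) ?[u \in C]uC //.
    by apply: contraNneq lalpha => <-.
  right; rewrite (_ : _ :\: _ = C :\: [set neg u | u in alpha]) //.
  apply/setP=> u; rewrite !inE; case: eqP => [->|//].
  suff -> : l \in [set neg w | w in alpha] by [].
  by apply/imsetP; exists (neg l); rewrite ?negK.
case: (inv _ dbot); first by case/pred0Pn => u; rewrite /= inE.
by rewrite set0D cards0.
Qed.

End Propagation.

(** * Links around a cycle *)

Section Cycle.
Variable m : nat.
Implicit Types (i j k v : 'I_m) (b c s : bool).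

Definition is_last i : bool := i.+1 == m.

(* The links of the cycle cannot all hold; dropping link j leaves exactly the
   two solutions [cut_solution j c]. *)
Definition holds (y : 'I_m -> bool) i : bool :=
  y i (+) y (ordS i) == is_last i.

Definition cut_solution j c v : bool := (v <= j) (+) c.

(** The value can change only after [j] and at the wrap-around; if the last link is not [j], the
    change it asks for does occur there. *)
Lemma holds_cut_solution i j c : i != j -> holds (cut_solution j c) i.
Proof.
rewrite /holds /cut_solution /is_last /= => ij.
have {}ij : (i : nat) != j by [].
have /orP[/eqP lt|lt] : (i.+1 == m) || (i.+1 < m) by rewrite -leq_eqVlt.
  rewrite lt modnn leq0n eqxx leqNgt.
  suff -> : j < i by case: c.
  by rewrite ltn_neqAle eq_sym ij -ltnS lt ltn_ord.
rewrite modn_small // (ltn_eqF lt) leq_eqVlt (negPf ij) /=.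
by case: (i < j); case: c.
Qed.

(** The links before the last carry the value of node 0 to every node, so the last link sees equal
    values. *)
Lemma holds_not_all (y : 'I_m -> bool) : 0 < m -> exists i, ~~ holds y i.
Proof.
move=> m_gt0; apply/existsP; rewrite -negb_forall; apply/negP => /forallP ally.
pose i0 := Ordinal m_gt0.
have const (k : nat) (ltk : k < m) : y (Ordinal ltk) = y i0.
  elim: k ltk => [|k IH] ltk; first by congr y; apply: val_inj.
  have ltk' : k < m := ltnW ltk.
  rewrite -(IH ltk'); have := ally (Ordinal ltk').
  rewrite /holds /is_last (_ : ordS _ = Ordinal ltk); last first.
    by apply: val_inj; rewrite /= modn_small.
  by rewrite (ltn_eqF ltk); case: (y _); case: (y _).
have ltl : m.-1 < m by rewrite prednK.
have := ally (Ordinal ltl).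
rewrite /holds /is_last (_ : ordS _ = i0); last first.
  by apply: val_inj; rewrite /= prednK // modnn.
by rewrite const /= prednK // eqxx addbb.
Qed.

Section Link.
Variables (V : finType) (y : 'I_m -> V).

(** Under [g], clause [b] forbids [y i = ~~ b] with the wrong value at the successor; both clauses
    together enforce the link. *)
Definition link_clause (g : V) i b : clause V :=
  [set (g, false); (y i, b); (y (ordS i), b (+) ~~ is_last i)].

Lemma link_clauseP g i (a : V -> bool) :
  (forall b, clause_eval (link_clause g i b) a) <->
  (a g -> holds (a \o y) i).
Proof.
have evalE b : clause_eval (link_clause g i b) a =
    [|| ~~ a g, a (y i) == b | a (y (ordS i)) == b (+) ~~ is_last i].
  apply/clause_evalP/or3P => [[u]|].
    rewrite !inE -orbA => /or3P[] /eqP-> /= ->;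
    by [constructor 1 | constructor 2 | constructor 3].
  case=> [/negPf ag|/eqP ay|/eqP ay].
  - by exists (g, false); rewrite ?inE ?eqxx.
  - by exists (y i, b); rewrite ?inE ?eqxx ?orbT.
  - by exists (y (ordS i), b (+) ~~ is_last i); rewrite ?inE ?eqxx ?orbT.
rewrite /holds /=; split=> [ev ag | h b].
  have := ev true; have := ev false; rewrite !evalE ag /=.
  by case: (a (y i)); case: (a (y _)); case: (is_last i).
rewrite evalE; case: (a g) h => //= /(_ isT).
by case: b; case: (a (y i)); case: (a (y _)); case: (is_last i).
Qed.

End Link.

(** * The q-Horn formula of the cycle *)

Definition cycle_var : finType := (('I_m * bool) + 'I_m)%type.

Definition cycle_cnf : cnf cycle_var :=
  [set link_clause inr (inl p.1) p.1.1 p.2 | p : 'I_m * bool * bool].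

Lemma cycle_cnfP (a : cycle_var -> bool) :
  cnf_eval cycle_cnf a <-> forall i s, a (inl (i, s)) -> holds (a \o inr) i.
Proof.
split=> [/cnf_evalP sat i s | h].
  by apply/link_clauseP => b; apply: sat; apply/imsetP; exists (i, s, b).
apply/cnf_evalP => _ /imsetP[[[i s] b] _ ->] /=.
by move: b; apply/link_clauseP/h.
Qed.

Lemma card_cycle_cnf : #|cycle_cnf| <= 4 * m.
Proof.
apply: leq_trans (leq_imset_card _ _) _.
by rewrite !card_prod card_ord card_bool -mulnA mulnC.
Qed.

Lemma vars_cycle_cnf : vars cycle_cnf = [set: cycle_var].
Proof.
apply/setP => x; rewrite [RHS]inE; apply/imsetP.
pose i := match x with inl p => p.1 | inr i => i end.
pose s := match x with inl p => p.2 | inr _ => true end.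
have inC u : u \in link_clause inr (inl (i, s)) i true -> u \in cover cycle_cnf.
  move=> uC; apply/bigcupP; exists (link_clause inr (inl (i, s)) i true) => //.
  by apply/imsetP; exists (i, s, true).
case: x @i @s inC => [[i s]|i] /= inC.
  by exists (inl (i, s), false) => //; apply: inC; rewrite !inE eqxx.
by exists (inr i, true) => //; apply: inC; rewrite !inE eqxx ?orbT.
Qed.

Lemma qHorn_cycle_cnf : qHorn cycle_cnf.
Proof.
pose gamma (u : literal cycle_var) : rat :=
  match u.1 with inl _ => (u.2 : nat)%:R%R | inr _ => (2^-1)%R end.
have gamma_ge0 u : (0 <= gamma u)%R by case: u => -[[i []]|i] [].
(* An upper bound suffices and covers coinciding literals, which occur in a cycle of length one. *)
have sumU1 u (A : clause cycle_var) :
    (\sum_(w in u |: A) gamma w <= gamma u + \sum_(w in A) gamma w)%R.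
  have [uA|uA] := boolP (u \in A); last by rewrite big_setU1.
  by rewrite (setUidPr _) ?sub1set // Num.Theory.lerDr.
exists gamma; split.
- by case=> -[p|i] [].
- by case=> -[p|i] [].
move=> _ /imsetP[[[i s] b] _ ->] /=.
rewrite /link_clause -setUA.
apply: Order.POrderTheory.le_trans (sumU1 _ _) _.
rewrite {1}/gamma /= GRing.add0r.
apply: Order.POrderTheory.le_trans (sumU1 _ _) _.
by rewrite big_set1.
Qed.

(** * Clauses forced on an equivalent URC formula *)

Section LowerBound.
Variable psi : cnf cycle_var.
Hypotheses (m_gt0 : 0 < m) (psiE : equivalent psi cycle_cnf) (psiU : URC psi).

Definition selected (z : 'I_m -> bool) i : literal cycle_var :=
  (inl (i, z i), true).

Definition selection z : {set literal cycle_var} := [set selected z i | i : 'I_m].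

Lemma in_neg_selection z u :
  (u \in [set neg w | w in selection z]) = 
  (if u.1 is inl p then (z p.1 == p.2) && ~~ u.2 else false).
Proof.
apply/imsetP/idP => [[_ /imsetP[i _ ->] ->] /=|]; first by rewrite eqxx.
case: u => -[[i s]|i] //= b /andP[/eqP zi /negPf ->].
by exists (selected z i); [rewrite imset_f | rewrite /neg /selected /= zi].
Qed.

Lemma in_selection z u :
  (u \in selection z) =
  (if u.1 is inl p then (z p.1 == p.2) && u.2 else false).
Proof.
apply/imsetP/idP => [[i _ ->] /=|]; first by rewrite eqxx.
case: u => -[[i s]|i] //= b /andP[/eqP zi ->].
by exists i => //; rewrite /selected zi.
Qed.

(** Unit refutation from the selection provides [D]. If [D] missed two literals of C_z, some link
    would have no negated selector in [D]; cutting the cycle there gives a model of the formula that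
    falsifies [D]. *)
Lemma selection_clause z : exists2 D, D \in psi &
  #|D :\: [set neg u | u in selection z]| <= 1 /\
  forall i j, i != j ->
    (neg (selected z i) \in D) || (neg (selected z j) \in D).
Proof.
have pa : partial_assignment (selection z).
  by move=> u; rewrite !in_selection /=; case: u => -[[i s]|i] [] //=; rewrite andbF.
have unsat : entails (conj_assignment psi (selection z)) bot.
  move=> a /cnf_eval_conj[]; rewrite psiE => /cycle_cnfP sat sel.
  have [i /negP[]] := holds_not_all (a \o inr) m_gt0.
  by apply: (sat i (z i)); apply: (sel (selected z i)); rewrite imset_f.
have [D Dpsi [Dsel D1]] := unit_refutation_starts pa (psiU pa unsat).
exists D => //; split=> // i j ij; apply/norP => -[niD njD].
have extra u w : u \in D -> u \notin [set neg t | t in selection z] ->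
    w \in D -> w \notin [set neg t | t in selection z] -> u = w.
  move=> uD un wD wn; apply: (card_le1_eqP D1); rewrite inE ?uD ?un ?wD ?wn //.
(* The single literal allowed outside C_z can touch only one of the links [i] and [j]; [k] is the
   other. *)
have [k noneg] : exists k, forall s, (inl (k, s), false) \notin D.
  have [oiD|oiD] := boolP ((inl (i, ~~ z i), false) \in D); last first.
    exists i => s; have [->|/eqP sz] := eqVneq s (z i); first exact: niD.
    by rewrite (_ : s = ~~ z i) //; move: sz; case: s; case: (z i).
  exists j => s; have [->|/eqP sz] := eqVneq s (z j); first exact: njD.
  have sE : s = ~~ z j by move: sz; case: s; case: (z j).
  apply/negP => ojD.
  have [] : (inl (i, ~~ z i), false) = (inl (j, s), false) :> literal cycle_var.
    by apply: extra => //; rewrite in_neg_selection /= ?sE; [case: (z i)|case: (z j)].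
  by move=> eij; rewrite eij eqxx in ij.
(* a falsifies D: its y-part may be flipped to falsify the only y-literal. *)
pose c := [exists v, (inr v, cut_solution k false v) \in D].
pose a (x : cycle_var) : bool := match x with
  | inl p => (inl p, false) \in D
  | inr v => cut_solution k c v end.
have : cnf_eval psi a.
  rewrite psiE; apply/cycle_cnfP => e s /= aD; apply: holds_cut_solution.
  by apply: contraTneq aD => ->; apply: noneg.
move/cnf_evalP/(_ D Dpsi)/clause_evalP => [[[[e s]|v] b] uD /= ab].
  case: b uD ab => [pD nD|]; last by move=> ->.
  (* A true positive selector literal has its negation in [D] as well; as [D] avoids the selection,
     both lie outside C_z, where only one literal fits. *)
  have := extra _ _ pD _ nD; rewrite !in_neg_selection /= andbF andbT => /(_ isT).
  suff -> : z e != s by move/(_ isT).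
  apply/negP => /eqP ze; move/pred0P: Dsel => /(_ (inl (e, s), true)) /=.
  by rewrite pD in_selection /= ze eqxx.
have yE w d : (inr w, d) \in D -> w = v /\ d = b.
  move=> wD; suff [-> ->] : (inr w, d) = (inr v, b) :> literal cycle_var by [].
  by apply: extra => //; rewrite in_neg_selection.
move: ab; rewrite /c; case: existsP => [[w wD]|none] ab.
  have [wv bE] := yE _ _ wD; move: ab; rewrite -bE wv /cut_solution.
  by case: (v <= k).
by case: none; exists v; rewrite ab.
Qed.

End LowerBound.

(** * The encoding with one gate per link *)

Definition encoding_var : finType := (cycle_var + 'I_m)%type.

Definition sel (p : 'I_m * bool) : encoding_var := inl (inl p).
Definition node i : encoding_var := inl (inr i).
Definition gate i : encoding_var := inr i.

Definition select_clause (p : 'I_m * bool) : clause encoding_var :=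
  [set (sel p, false); (gate p.1, true)].

Definition gates_clause : clause encoding_var := [set (gate i, false) | i : 'I_m].

Definition cycle_encoding : cnf encoding_var :=
  gates_clause |: ([set select_clause p | p : 'I_m * bool] :|:
    [set link_clause node (gate p.1) p.1 p.2 | p : 'I_m * bool]).

Lemma card_cycle_encoding : #|cycle_encoding| <= 4 * m + 1.
Proof.
rewrite cardsU1 addnC leq_add ?leq_b1 //.
apply: leq_trans (leq_card_setU _ _) _.
apply: leq_trans (leq_add (leq_imset_card _ _) (leq_imset_card _ _)) _.
by rewrite !card_prod card_ord card_bool addnn -mul2n [m * 2]mulnC mulnA.
Qed.

Lemma gates_clause_in : gates_clause \in cycle_encoding.
Proof. by rewrite !inE eqxx. Qed.

Lemma select_clause_in p : select_clause p \in cycle_encoding.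
Proof. by rewrite !inE imset_f ?orbT. Qed.

Lemma link_clause_in i b : link_clause node (gate i) i b \in cycle_encoding.
Proof.
rewrite !inE; apply/orP; right; apply/orP; right.
by apply/imsetP; exists (i, b).
Qed.

Lemma cycle_encodingP (a : encoding_var -> bool) :
  cnf_eval cycle_encoding a <->
  [/\ exists i, ~~ a (gate i),
      forall i s, a (sel (i, s)) -> a (gate i)
    & forall i, a (gate i) -> holds (a \o node) i].
Proof.
split=> [/cnf_evalP sat | [[i ai] selP linkP]].
  split.
  - have /clause_evalP[_ /imsetP[i _ ->] /= ai] := sat _ gates_clause_in.
    by exists i; rewrite ai.
  - move=> i s ais; have /clause_evalP[u] := sat _ (select_clause_in (i, s)).
    by rewrite !inE => /orP[] /eqP-> //=; rewrite ais.
  - by move=> i; apply/link_clauseP => b; apply/sat/link_clause_in.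
apply/cnf_evalP => C /setU1P[->|/setUP[]/imsetP[[j b] _ ->]].
- by apply/clause_evalP; exists (gate i, false); [rewrite imset_f | apply/negbTE].
- apply/clause_evalP; have := selP j b; case ajb: (a (sel (j, b))) => ajP.
    by exists (gate j, true); rewrite ?inE ?eqxx ?orbT ?ajP.
  by exists (sel (j, b), false); rewrite ?inE ?eqxx.
- by rewrite /=; move: b; apply/link_clauseP/linkP.
Qed.

Lemma encoding_cycle_encoding :
  0 < m -> encoding cycle_encoding (cnf_eval cycle_cnf).
Proof.
move=> m_gt0 a; split=> [/cycle_cnfP sat | [b /cycle_encodingP[_ selP linkP]]].
  (* Each gate takes the least value its selectors allow, so only links already known to hold are
     enforced. *)
  exists (fun i => a (inl (i, true)) || a (inl (i, false))).
  have hold i : a (inl (i, true)) || a (inl (i, false)) -> holds (a \o inr) i.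
    by case/orP => /sat.
  apply/cycle_encodingP; split=> [|i s|//] /=.
    have [i ni] := holds_not_all (a \o inr) m_gt0.
    by exists i; apply: contra ni => /hold.
  by case: s => ->; rewrite ?orbT.
by apply/cycle_cnfP => i s ais; apply/linkP/(selP i s).
Qed.

(** * Propagation completeness of the encoding *)

Section PropagationComplete.
Variable alpha : {set literal encoding_var}.
Let Phi := conj_assignment cycle_encoding alpha.
Hypothesis no_conflict : ~ unit_derives Phi bot.

Let U (u : literal encoding_var) : bool := `[< unit_derives Phi [set u] >].

Let U_neg u : U u -> U (neg u) = false.
Proof.
move=> /asboolP du; apply/negP => /asboolP dnu.
exact/no_conflict/(unit_derives_clash du).
Qed.

Let U_last C u : C \in cycle_encoding -> u \in C ->
  (forall w, w \in C -> w != u -> U (neg w)) -> U u.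
Proof.
move=> Cin uC UC; apply/asboolP/(@unit_derives_last _ _ C) => //.
  by rewrite inE Cin.
by move=> w wC wu; apply/asboolP/UC.
Qed.

Let U_select i s : U (sel (i, s), true) -> U (gate i, true).
Proof.
move=> Us; apply: U_last (select_clause_in (i, s)) _ _; rewrite ?inE ?eqxx ?orbT //.
by move=> v; rewrite !inE => /orP[] /eqP->; rewrite ?eqxx.
Qed.

Let U_unselect i s : U (gate i, false) -> U (sel (i, s), false).
Proof.
move=> Us; apply: U_last (select_clause_in (i, s)) _ _; rewrite ?inE ?eqxx ?orbT //.
by move=> v; rewrite !inE => /orP[] /eqP->; rewrite ?eqxx.
Qed.

Let U_next i b : U (gate i, true) -> U (node i, b) ->
  U (node (ordS i), b (+) is_last i).
Proof.
move=> Ug Ui; apply: U_last (link_clause_in i (~~ b)) _ _.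
  by rewrite !inE; apply/orP; right; case: b {Ui}; case: is_last.
move=> v; rewrite !inE -orbA => /or3P[] /eqP-> //=; last first.
  by case: b {Ui}; case: is_last; rewrite /= eqxx.
by rewrite /neg /= negbK.
Qed.

Let U_prev i b : U (gate i, true) -> U (node (ordS i), b (+) is_last i) ->
  U (node i, b).
Proof.
move=> Ug Ui; apply: U_last (link_clause_in i b) _ _.
  by rewrite !inE eqxx orbT.
move=> v; rewrite !inE -orbA => /or3P[] /eqP-> //=; rewrite ?eqxx //.
by move: Ui; rewrite /neg /=; case: b; case: is_last.
Qed.

Let U_gate_false i b : U (node i, b) ->
  U (node (ordS i), b (+) ~~ is_last i) -> U (gate i, false).
Proof.
move=> Ui Un; apply: U_last (link_clause_in i (~~ b)) _ _.
  by rewrite !inE eqxx.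
move=> v; rewrite !inE -orbA => /or3P[] /eqP-> //=; rewrite ?eqxx //.
  by rewrite /neg /= negbK.
by move: Un; rewrite /neg /=; case: b {Ui}; case: is_last.
Qed.

Let open_gate : exists j, ~~ U (gate j, true).
Proof.
apply/existsP; rewrite -negb_forall; apply/negP => /forallP allU.
apply: no_conflict; apply: (@unit_derives_falsified _ _ gates_clause).
  by rewrite inE gates_clause_in.
by move=> _ /imsetP[i _ ->]; apply/asboolP/allU.
Qed.

(** If all other gates were propagated on, [gates_clause] would propagate gate [i] off. *)
Let other_open_gate i : ~~ U (gate i, false) ->
  exists2 j, j != i & ~~ U (gate j, true).
Proof.
move=> nUi; suff /exists_inP[j ji Uj] : [exists j in [pred j | j != i], ~~ U (gate j, true)].
  by exists j.
apply: contraNT nUi => /exists_inPn allU.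
apply: U_last gates_clause_in _ _; first exact: imset_f.
move=> _ /imsetP[j _ ->] ji; apply: contraTT isT => nU.
have /allU : j \in [pred j | j != i] by apply: contraNneq ji => ->.
by rewrite nU.
Qed.

(* Propagated nodes keep their value; all others follow one cut solution, which
   is consistent since a propagated gate equates the status of its two nodes. *)
Definition node_value j c v : bool :=
  if U (node v, true) then true
  else if U (node v, false) then false else cut_solution j c v.

Let node_valueT j c v b : U (node v, b) -> node_value j c v = b.
Proof.
rewrite /node_value; case: b => [-> //|Uf].
by rewrite Uf (U_neg Uf : U (node v, true) = false).
Qed.

Let node_valueF j c v : (forall b, ~~ U (node v, b)) ->
  node_value j c v = cut_solution j c v.
Proof. by move=> nU; rewrite /node_value !ifN. Qed.

Let node_statusP v :
  (exists b, U (node v, b)) \/ (forall b, ~~ U (node v, b)).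
Proof.
have [Ut|nt] := boolP (U (node v, true)); first by left; exists true.
have [Uf|nf] := boolP (U (node v, false)); first by left; exists false.
by right; case.
Qed.

Let holds_propagated j c i : ~~ U (gate j, true) -> U (gate i, true) ->
  holds (node_value j c) i.
Proof.
move=> nUj Ui; rewrite /holds.
have [[b Ub]|nU] := node_statusP i.
  by rewrite (node_valueT _ _ Ub) (node_valueT _ _ (U_next Ui Ub)) addbA addbb.
have nU' b : ~~ U (node (ordS i), b).
  apply: contra (nU (b (+) is_last i)) => Ub; apply: U_prev => //.
  by rewrite -addbA addbb addbF.
rewrite !node_valueF //; apply: holds_cut_solution.
by apply: contraNneq nUj => <-.
Qed.

(** Two propagated ends satisfy the link, or gate [i] would be propagated off. With one propagated
    end, [c] is solved for so that the cut solution gives the other end the required value. With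
    none, the cut at [j != i] respects the link. *)
Let holds_open i : ~~ U (gate i, false) -> exists j c,
  [/\ j != i, ~~ U (gate j, true) & holds (node_value j c) i].
Proof.
move=> nUi; have [j ji nUj] := other_open_gate nUi; exists j.
have [[b Ub]|nU] := node_statusP i; have [[b' Ub']|nU'] := node_statusP (ordS i).
- exists true; split=> //; rewrite /holds (node_valueT _ _ Ub) (node_valueT _ _ Ub').
  apply: contraNT nUi => bb'; apply: (U_gate_false Ub).
  rewrite (_ : _ (+) _ = b') //.
  by move: bb'; case: b {Ub}; case: b' {Ub'}; case: is_last.
- exists (b (+) is_last i (+) (ordS i <= j)); split=> //.
  rewrite /holds (node_valueT _ _ Ub) node_valueF // /cut_solution.
  by case: b {Ub}; case: is_last; case: (ordS i <= j).
- exists (b' (+) is_last i (+) (i <= j)); split=> //.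
  rewrite /holds (node_valueT _ _ Ub') node_valueF // /cut_solution.
  by case: b' {Ub'}; case: is_last; case: (i <= j).
- exists true; split=> //; rewrite /holds !node_valueF //.
  by apply: holds_cut_solution; rewrite eq_sym.
Qed.

(** [T] and [E] are the gates and selectors switched on beyond the propagated ones. *)
Definition completion j c (T : pred 'I_m) (E : pred ('I_m * bool))
    (x : encoding_var) : bool :=
  match x with
  | inl (inl p) => U (sel p, true) || E p
  | inl (inr v) => node_value j c v
  | inr i => U (gate i, true) || T i
  end.

Let completion_sat j c (T : pred 'I_m) (E : pred ('I_m * bool)) :
  ~~ U (gate j, true) -> ~~ T j ->
  (forall i, T i -> ~~ U (gate i, false) /\ holds (node_value j c) i) ->
  (forall i s, E (i, s) -> T i /\ ~~ U (sel (i, s), false)) ->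
  cnf_eval Phi (completion j c T E).
Proof.
move=> nUj nTj TP EP; apply/cnf_eval_conj; split.
  apply/cycle_encodingP; split=> [|i s|i] /=.
  - by exists j; rewrite negb_or nUj.
  - by case/orP => [/U_select -> //|/EP[-> _]]; rewrite orbT.
  - by case/orP => [/(holds_propagated c nUj)|/TP[]].
move=> u ualpha; have {ualpha} : U u.
  by apply/asboolP/ud_axiom; rewrite inE imset_f ?orbT.
case: u => -[[[i s]|v]|i] b /= Ub.
- case: b Ub => [-> //|Uf]; rewrite (U_neg Uf : U (sel (i, s), true) = false) /=.
  by apply/negP => /EP[_ /negP[]].
- exact: node_valueT.
- case: b Ub => [-> //|Uf]; rewrite (U_neg Uf : U (gate i, true) = false) /=.
  by apply/negP => /TP[/negP[]].
Qed.

(** Every unpropagated literal fails in some completion: a positive gate or selector literal when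
    nothing extra is on, a negative one when that gate or selector is switched on, a node literal
    for a suitable [c]. *)
Lemma propagated_of_entailed l :
  entails Phi (unit_clause l) -> unit_derives Phi (unit_clause l).
Proof.
move=> ent; suff : U l by move/asboolP.
have {ent}sat a : cnf_eval Phi a -> a l.1 = l.2.
  by move/ent/clause_evalP => [u /set1P ->].
have base j c : ~~ U (gate j, true) -> cnf_eval Phi (completion j c pred0 pred0).
  by move=> nUj; apply: completion_sat.
have [j nUj] := open_gate.
have closed i (E : pred ('I_m * bool)) : ~~ U (gate i, false) ->
    (forall k s, E (k, s) -> k = i /\ ~~ U (sel (k, s), false)) ->
    exists j c, cnf_eval Phi (completion j c (pred1 i) E).
  move=> nUi EP; have [k [c [ki nUk hk]]] := holds_open nUi.
  exists k, c; apply: completion_sat => // [e /eqP-> //|e s /EP[-> ?]].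
  by rewrite /= eqxx.
apply: contraPT isT => nUl _.
case: l nUl sat => -[[[i s]|v]|i] b /= nUl sat.
- case: b nUl sat => nUl sat.
    by have /= := sat _ (base j true nUj); rewrite (negPf nUl).
  have nUi : ~~ U (gate i, false) by apply: contra nUl => Ui; apply: U_unselect.
  have [|k [c]] := closed i (pred1 (i, s)) nUi; first by move=> k t /eqP[-> ->].
  by move/sat; rewrite /= eqxx orbT.
(* This [c] gives the cut solution the value [~~ b] at [v]. *)
- have := sat _ (base j (~~ b (+) (v <= j)) nUj).
  rewrite /= /node_value; have [Ut|_] := boolP (U (node v, true)).
    by move=> bE; rewrite -bE Ut in nUl.
  have [Uf|_] := boolP (U (node v, false)).
    by move=> bE; rewrite -bE Uf in nUl.
  by rewrite /cut_solution; case: b {nUl sat}; case: (v <= j).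
- case: b nUl sat => nUl sat.
    by have /= := sat _ (base j true nUj); rewrite (negPf nUl).
  have [//|k [c]] := closed i pred0 nUl.
  by move/sat; rewrite /= eqxx orbT.
Qed.

End PropagationComplete.

Lemma PC_cycle_encoding : PC cycle_encoding.
Proof.
move=> alpha l _ ent.
have [|noconf] := pselect (unit_derives (conj_assignment cycle_encoding alpha) bot).
  by right.
by left; apply: propagated_of_entailed.
Qed.

End Cycle.

(** * Counting the forced clauses *)

(* Repeating each bit three times makes selections differ in three positions,
   which the two possible deviations of a clause from a selection cannot hide. *)
Lemma card_URC_cycle_cnf n (psi : cnf (cycle_var (3 * n))) :
  0 < n -> equivalent psi (cycle_cnf (3 * n)) -> URC psi -> 2 ^ n <= #|psi|.
Proof.
move=> n_gt0 psiE psiU.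
have m_gt0 : 0 < 3 * n by rewrite muln_gt0.
pose z (f : {ffun 'I_n -> bool}) (i : 'I_(3 * n)) :=
  f (Ordinal (ltn_pmod i n_gt0)).
have /choice[D DP] f : exists D, D \in psi /\
  (#|D :\: [set neg u | u in selection (z f)]| <= 1 /\
  forall i j, i != j ->
    (neg (selected (z f) i) \in D) || (neg (selected (z f) j) \in D)).
  by have [D] := selection_clause m_gt0 psiE psiU (z f); exists D.
have <- : #|{ffun 'I_n -> bool}| = 2 ^ n by rewrite card_ffun card_bool card_ord.
have Dinj : injective D.
  move=> f g Dfg; apply/ffunP => t; apply/eqP/negPn/negP => fgt.
  have [_ [_ Df]] := DP f; have [_ [Dg _]] := DP g.
  have lt3 (r : 'I_3) : t + r * n < 3 * n.
    by apply: (@leq_trans (r.+1 * n)); rewrite ?leq_mul2r ?ltn_ord ?orbT // mulSn ltn_add2r.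
  pose copy r := Ordinal (lt3 r).
  have zcopy h r : z h (copy r) = h t.
    by congr (h _); apply: val_inj; rewrite /= addnC modnMDl modn_small.
  have copy_inj : injective copy.
    by move=> r r' [/addnI/eqP]; rewrite eqn_pmul2r // => /eqP/val_inj.
  (* As [f t] and [g t] differ, these literals lie outside the negated selection of [z g], so the
     shared clause has at most one of them; but [Df] demands two of the three. *)
  have one r r' : neg (selected (z f) (copy r)) \in D f ->
      neg (selected (z f) (copy r')) \in D f -> r = r'.
    have out q : neg (selected (z f) (copy q)) \in D f ->
        neg (selected (z f) (copy q)) \in D g :\: [set neg u | u in selection (z g)].
      by move=> qD; rewrite inE -Dfg qD andbT in_neg_selection /= !zcopy andbT eq_sym.
    move=> /out rD /out r'D; apply: copy_inj.
    pose index (u : literal (cycle_var (3 * n))) := if u.1 is inl p then p.1 else copy r.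
    by have /(congr1 index) := card_le1_eqP Dg _ _ rD r'D.
  pose r0 : 'I_3 := inord 0; pose r1 : 'I_3 := inord 1; pose r2 : 'I_3 := inord 2.
  have ne (r r' : 'I_3) : r != r' -> (neg (selected (z f) (copy r)) \in D f) ||
      (neg (selected (z f) (copy r')) \in D f).
    by move=> rr'; apply: Df; rewrite (inj_eq copy_inj).
  have r01 : r0 != r1 by rewrite -val_eqE /= !inordK.
  have r02 : r0 != r2 by rewrite -val_eqE /= !inordK.
  have r12 : r1 != r2 by rewrite -val_eqE /= !inordK.
  have [A|A] := orP (ne _ _ r01).
    have [/(one _ _ A)|/(one _ _ A)] := orP (ne _ _ r12); exact/eqP.
  have [/(one _ _ A)/esym|/(one _ _ A)] := orP (ne _ _ r02); exact/eqP.
rewrite -(card_imset _ Dinj); apply/subset_leq_card/subsetP => _ /imsetP[f _ ->].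
by have [] := DP f.
Qed.

(* 2 ^ n <= #|psi| ^ k says that the size of psi is at least 2 ^ (n / k). *)
Theorem theorem3 :
  exists c d k n0 : nat, 0 < k /\
  forall n : nat, 1 <= n ->
  exists (V : finType) (phi : cnf V),
    [/\ vars phi = [set: V],
        qHorn phi,
        #|phi| <= c * n,
        (n0 <= n ->
         forall psi : cnf V,
           equivalent psi phi -> URC psi -> 2 ^ n <= #|psi| ^ k)
      & exists (W : finType) (psi : cnf (V + W)%type),
          [/\ encoding psi (cnf_eval phi),
              PC psi,
              URC psi
            & #|psi| <= d * n]].
Proof.
(* For cycle length [3 * n], the bounds [4 * m] and [4 * m + 1] become [12 * n] and, as [1 <= n],
   [13 * n]. *)
exists 12, 13, 1, 0; split=> // n n_gt0.
have m_gt0 : 0 < 3 * n by rewrite muln_gt0.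
exists (cycle_var (3 * n)), (cycle_cnf (3 * n)); split.
- exact: vars_cycle_cnf.
- exact: qHorn_cycle_cnf.
- by rewrite -[12]/(4 * 3) -mulnA card_cycle_cnf.
- by move=> _ psi psiE psiU; rewrite expn1; apply: card_URC_cycle_cnf.
exists 'I_(3 * n), (cycle_encoding (3 * n)); split.
- exact: encoding_cycle_encoding.
- exact: PC_cycle_encoding.
- exact: (PC_URC (inr (Ordinal m_gt0)) (@PC_cycle_encoding _)).
- apply: leq_trans (card_cycle_encoding _) _.
  by rewrite mulnA -[13]/(12 + 1) mulnDl leq_add2l mul1n.
Qed.
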